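(* For every integer $k \ge 2$ there are infinitely many integers $n$ for which there is a tournament with $n$ vertices in which the longest $k$th power of a path has at most $nk/2^{k/2}$ vertices.
   Context: A tournament is an orientation of a complete graph (finite and simple). The $k$th power of a directed path $v_1 v_2 \cdots v_m$ is the directed graph on $v_1,\ldots,v_m$ whose edges are all $v_i v_j$ (directed from $v_i$ to $v_j$) with $i+1 \le j \le i+k$ (and $j \le m$). A tournament contains a $k$th power of a path on $m$ vertices if it has distinct vertices $v_1,\ldots,v_m$ such that all these edges are edges of the tournament; ''longest'' refers to the number $m$ of vertices. *)

(* Defs.v *)
From mathcomp Require Import all_boot.

Set Implicit Arguments.
Unset Strict Implicit.
Unset Printing Implicit Defensive.

(* The relation [e x y] reads "there is an edge directed from x to y". *)
Definition tournament (V : finType) (e : rel V) : Prop :=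
  irreflexive e /\ forall x y : V, x != y -> e x y (+) e y x.

Definition contains_path_power (V : finType) (e : rel V) (k m : nat) : bool :=
  [exists v : {ffun 'I_m -> V},
     injectiveb v &&
     [forall i : 'I_m, forall j : 'I_m,
        (i.+1 <= j <= i + k) ==> e (v i) (v j)]].

(* The vertices of a power of a path are distinct, so there are at most #|V| of
   them and the maximum can be taken over m <= #|V|. *)
Definition longest_path_power (V : finType) (e : rel V) (k : nat) : nat :=
  \max_(m < #|V|.+1 | contains_path_power e k m) m.

Lemma longest_path_power_max (V : finType) (e : rel V) (k m : nat) :
  contains_path_power e k m -> m <= longest_path_power e k.
Proof.
move=> em; have ltm : m < #|V|.+1.
  case/existsP: em => v /andP[/injectiveP vi _].
  by rewrite ltnS -[m]card_ord; apply: leq_card vi.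
exact: (@leq_bigmax_cond _ (fun i : 'I__ => contains_path_power e k i)
          (fun i => i : nat) (Ordinal ltm) em).
Qed.

Lemma longest_path_power_attained (V : finType) (e : rel V) (k : nat) :
  contains_path_power e k (longest_path_power e k).
Proof.
have e0 : contains_path_power e k (ord0 : 'I_#|V|.+1).
  apply/existsP; exists (ffun0 (card_ord 0)).
  by apply/andP; split; [apply/injectiveP => -[] | apply/forallP => -[]].
by rewrite /longest_path_power (bigmax_eq_arg ord0) //; case: arg_maxnP.
Qed.

(* Main.v *)
Require Import Defs.
From mathcomp Require Import all_boot all_order all_algebra.
From mathcomp Require Import all_classical all_reals all_analysis.
From mathcomp Require Import zify.

(** Any [k + 1] consecutive vertices of a [k]th power of a path induce a
    transitive tournament.  Erdos and Moser's counting argument gives a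
    tournament [A] on [N >= 2 ^ (k / 2)] vertices without a transitive
    subtournament on [k + 1] vertices.  Put [m] copies of [A] in a row, with all
    edges between different copies directed forward.  A power of a path can
    never return to an earlier copy, and [k] steps along it must leave the
    current copy, since otherwise [k + 1] consecutive vertices would be a
    transitive subtournament of [A].  So its vertex number [q * k], counted from
    [0], lies at least [q] copies after the beginning, and there are at most
    [m * k] vertices ([leq_path_power_lex_sum]).  As [n = m * N], this is
    [n * k / N], at most [n * k / 2 ^ (k / 2)], and letting [m] vary gives
    infinitely many [n].

    For the existence of [A] ([transitive_free_tournament]): an ordered list of
    [k + 1] distinct vertices is transitive, in its order, in a fraction
    [2 ^ - 'C(k + 1, 2)] of all tournaments, so a tournament avoiding all the
    lists exists as soon as [N ^_ (k + 1) < 2 ^ 'C(k + 1, 2)].  The least [N]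
    with [2 ^ k <= N ^ 2] qualifies ([Erdos_Moser_order]): the falling factorial
    has at least three factors, so it is at most [(N - 1) ^ (k + 1)], whereas
    [(N - 1) ^ 2 < 2 ^ k] by minimality.  Rounding up like this covers odd [k],
    where [2 ^ (k / 2)] is not an integer. *)

Set Implicit Arguments.
Unset Strict Implicit.
Unset Printing Implicit Defensive.

Import Order.TTheory GRing.Theory Num.Theory.

(** * Restricting a relation along an injection *)

Lemma contains_path_power_relpre (U V : finType) (e : rel V) (f : U -> V)
    (k m : nat) :
  injective f ->
  contains_path_power (relpre f e) k m -> contains_path_power e k m.
Proof.
move=> f_inj /existsP[v /andP[/injectiveP v_inj /forallP ve]].
apply/existsP; exists [ffun i => f (v i)]; apply/andP; split.
  by apply/injectiveP => i j; rewrite !ffunE => /f_inj /v_inj.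
apply/forallP => i; apply/forallP => j; rewrite !ffunE.
exact: (forallP (ve i) j).
Qed.

Lemma longest_path_power_relpre (U V : finType) (e : rel V) (f : U -> V)
    (k : nat) :
  injective f -> longest_path_power (relpre f e) k <= longest_path_power e k.
Proof.
move=> f_inj; apply: longest_path_power_max.
exact: contains_path_power_relpre f_inj (longest_path_power_attained _ _).
Qed.

Lemma tournament_relpre (U V : finType) (e : rel V) (f : U -> V) :
  injective f -> tournament e -> tournament (relpre f e).
Proof.
move=> f_inj [e_irr e_tot]; split=> [x | x y xy]; first exact: e_irr.
by apply: e_tot; rewrite (inj_eq f_inj).
Qed.

(** * Copies of a tournament in a row *)

Definition lex_sum (m : nat) (V : finType) (e : rel V) : rel ('I_m * V) :=
  fun x y => (x.1 < y.1) || (x.1 == y.1) && e x.2 y.2.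
Arguments lex_sum m {V} e.

Lemma tournament_lex_sum (m : nat) (V : finType) (e : rel V) :
  tournament e -> tournament (lex_sum m e).
Proof.
move=> [e_irr e_tot]; split=> [x | [a x] [b y]].
  by rewrite /lex_sum ltnn eqxx e_irr.
rewrite /lex_sum /= xpair_eqE -!(inj_eq val_inj) /=.
by case: ltngtP => //= _; apply: e_tot.
Qed.

(** A [k]th power of a path on [k.+1] vertices is a transitive tournament.  The
    bound holds because without one in [e], every [k] steps along the path
    strictly increase the index of the copy. *)
Lemma leq_path_power_lex_sum (m k l : nat) (V : finType) (e : rel V) :
  0 < k -> ~~ contains_path_power e k k.+1 ->
  contains_path_power (lex_sum m e) k l -> l <= m * k.
Proof.
move=> k_gt0 no_trans /existsP[v /andP[/injectiveP v_inj /forallP ve]].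
rewrite leqNgt; apply/negP => ltl.
have l_gt0 : 0 < l by apply: leq_ltn_trans ltl.
(* Reading [v] on natural numbers; values from [l] on are junk. *)
pose w i : 'I_m * V := v (insubd (Ordinal l_gt0) i).
have w_inj i j : i < l -> j < l -> w i = w j -> i = j.
  by move=> li lj /v_inj /(congr1 val); rewrite /= !insubdK.
have we i j : i < j -> j <= i + k -> j < l -> lex_sum m e (w i) (w j).
  move=> ij jik lj; have li : i < l by apply: ltn_trans lj.
  have := forallP (ve (insubd (Ordinal l_gt0) i)) (insubd (Ordinal l_gt0) j).
  by rewrite !insubdK // ij jik => /implyP; apply.
have w_step i : i.+1 < l -> (w i).1 <= (w i.+1).1.
  move=> li; have /orP[/ltnW //|/andP[/eqP-> //]] : lex_sum m e (w i) (w i.+1).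
  by apply: we => //; rewrite -addn1 leq_add2l.
have w_mono i d : i + d < l -> (w i).1 <= (w (i + d)).1.
  elim: d => [|d IHd]; rewrite ?addn0 // addnS => li.
  by apply: leq_trans (w_step _ li); apply: IHd; apply: ltnW.
have w_jump i : i + k < l -> (w i).1 < (w (i + k)).1.
  move=> li; rewrite ltnNge; apply/negP => block_le.
  (* By monotonicity the path then stays in one copy for [k.+1] vertices, which
     are transitive there. *)
  have block_eq d : d <= k -> (w (i + d)).1 = (w i).1.
    move=> dk; apply/val_inj/eqP; rewrite eqn_leq w_mono ?andbT; last by lia.
    apply: leq_trans block_le; rewrite -(subnKC dk) addnA w_mono //; lia.
  case/negP: no_trans; apply/existsP.
  exists [ffun d : 'I_k.+1 => (w (i + d)).2]; apply/andP; split.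
    apply/injectiveP => a b; rewrite !ffunE => ab.
    have leak := ltn_ord a; have lebk := ltn_ord b.
    apply: val_inj => /=; apply: (@addnI i); apply: w_inj; [lia|lia|].
    apply: injective_projections => //.
    by rewrite !block_eq.
  apply/forallP => a; apply/forallP => b; apply/implyP => /andP[ab _].
  have leak := ltn_ord a; have lebk := ltn_ord b.
  have : lex_sum m e (w (i + a)) (w (i + b)) by apply: we; lia.
  by rewrite !ffunE /lex_sum !block_eq // ltnn eqxx.
(* The vertex [m * k] would have to lie in a copy of index at least [m]. *)
have w_block q : q * k < l -> q <= (w (q * k)).1.
  elim: q => // q IHq; rewrite mulSnr => lq.
  apply: leq_ltn_trans (w_jump _ lq); apply: IHq; lia.
by have := w_block m ltl; rewrite leqNgt ltn_ord.
Qed.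

(** * Counting tournaments with a given transitive list *)

(** The tournaments on ['I_N] are indexed by 2-colorings of the pairs of
    vertices, a pair being [true] when its edge goes down in the order of ['I_N].
    Coloring all subsets, not only pairs, multiplies every count by the same
    factor and spares a type of pairs. *)
Definition coloring_rel (N : nat) (c : {ffun {set 'I_N} -> bool}) : rel 'I_N :=
  fun x y => (x != y) && (c [set x; y] (+) (x < y)).

Lemma tournament_coloring_rel (N : nat) (c : {ffun {set 'I_N} -> bool}) :
  tournament (coloring_rel c).
Proof.
split=> [x | x y xy]; first by rewrite /coloring_rel eqxx.
rewrite /coloring_rel [y == x]eq_sym xy (finset.setUC [set y]) /=.
by move: xy; rewrite -(inj_eq val_inj) /=; case: ltngtP => //; case: (c _).
Qed.

Definition transitive_along (N s : nat) (v : 'I_s -> 'I_N)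
    (c : {ffun {set 'I_N} -> bool}) : bool :=
  [forall i : 'I_s, forall j : 'I_s, (i < j) ==> coloring_rel c (v i) (v j)].

Lemma card_ffun_agree (T : finType) (S : {set T}) (c0 : {ffun T -> bool}) :
  #|[set c : {ffun T -> bool} | [forall x in S, c x == c0 x]]| * 2 ^ #|S|
    = 2 ^ #|T|.
Proof.
pose F x := if x \in S then pred1 (c0 x) else predT.
have -> : #|[set c : {ffun T -> bool} | [forall x in S, c x == c0 x]]|
            = #|family F|.
  apply: eq_card => c; rewrite inE; apply/forall_inP/familyP => agree x.
    by rewrite /F; case: ifP => // /agree.
  by move=> xS; have := agree x; rewrite /F xS.
rewrite card_family foldrE big_image /= -!prod_nat_const.
rewrite [X in _ * X]big_mkcond -big_split /=.
apply: eq_bigr => x _; rewrite /F.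
by case: (x \in S); rewrite ?card1 ?cardT -?cardE ?card_bool.
Qed.

(** Transitivity along [v] determines the colors of the ['C(s, 2)] pairs of
    entries of [v]: any two colorings with it agree on all these pairs. *)
Lemma leq_card_transitive_along (N s : nat) (v : 'I_s -> 'I_N) :
  injective v ->
  #|[set c | transitive_along v c]| * 2 ^ 'C(s, 2) <= 2 ^ #|{set 'I_N}|.
Proof.
move=> v_inj; have [-> | [c0]] := set_0Vmem [set c | transitive_along v c].
  by rewrite cards0.
rewrite inE => /forallP v_c0.
pose S := [set A : {set 'I_N} | (A \subset v @: 'I_s) && (#|A| == 2)].
have cardS : #|S| = 'C(s, 2) by rewrite cards_draws card_imset // card_ord.
rewrite -(card_ffun_agree S c0) cardS leq_mul2r; apply/orP; right.
apply: subset_leq_card; apply/fintype.subsetP => c; rewrite !inE => /forallP v_c.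
apply/forall_inP => A; rewrite inE => /andP[sAv /cards2P[x [y [xy defA]]]].
have agree (i j : 'I_s) : i < j -> c [set v i; v j] = c0 [set v i; v j].
  move=> ij; move: (forallP (v_c i) j) (forallP (v_c0 i) j).
  rewrite ij /coloring_rel /= => /andP[_ +] /andP[_ +].
  by case: (c _); case: (c0 _); case: (_ < _).
move: sAv; rewrite defA finset.subUset !finset.sub1set.
case/andP => /imsetP[i _ xi] /imsetP[j _ yj]; rewrite xi yj.
have : i != j by apply: contraNneq xy => ij; rewrite xi yj ij.
rewrite -(inj_eq val_inj) /=; case: ltngtP => // ij _; first by rewrite agree.
by rewrite finset.setUC agree.
Qed.

(** * Tournaments without large transitive subtournaments *)

(** Union bound over the [N ^_ k.+1] injective lists of vertices. *)
Lemma transitive_free_tournament (N k : nat) :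
  N ^_ k.+1 < 2 ^ 'C(k.+1, 2) ->
  exists2 e : rel 'I_N, tournament e & ~~ contains_path_power e k k.+1.
Proof.
move=> few.
suff /existsP[c free] : [exists c : {ffun {set 'I_N} -> bool},
    ~~ contains_path_power (coloring_rel c) k k.+1].
  by exists (coloring_rel c) => //; apply: tournament_coloring_rel.
apply: contraLR few => /existsPn all_bad; rewrite -leqNgt.
have cover : [set: {ffun {set 'I_N} -> bool}] \subset
    \bigcup_(v : {ffun 'I_k.+1 -> 'I_N} | injectiveb v)
      [set c | transitive_along v c].
  apply/fintype.subsetP => c _; have := all_bad c; rewrite negbK.
  move=> /existsP[v /andP[v_inj /forallP ve]].
  apply/bigcupP; exists v => //; rewrite inE.
  apply/forallP => i; apply/forallP => j; apply/implyP => ij.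
  have /implyP := forallP (ve i) j; apply; rewrite ij /=.
  have := ltn_ord j; lia.
have := subset_leq_card cover; rewrite cardsT card_ffun card_bool => total.
rewrite -(leq_pmul2l (expn_gt0 2 #|{set 'I_N}|)).
apply: (@leq_trans (\sum_(v : {ffun 'I_k.+1 -> 'I_N} | injectiveb v)
    #|[set c | transitive_along v c]| * 2 ^ 'C(k.+1, 2))).
  rewrite -big_distrl leq_mul2r; apply/orP; right.
  apply: leq_trans total _; elim/big_rec2: _ => [|v n A _ An].
    by rewrite cards0.
  by apply: leq_trans (leq_card_setU _ _) _; rewrite leq_add2l.
apply: (@leq_trans (\sum_(v : {ffun 'I_k.+1 -> 'I_N} | injectiveb v)
    2 ^ #|{set 'I_N}|)).
  by apply: leq_sum => v /injectiveP; apply: leq_card_transitive_along.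
rewrite sum_nat_const mulnC leq_mul2l; apply/orP; right.
have := card_inj_ffuns 'I_k.+1 'I_N; rewrite !card_ord => <-.
by rewrite cardsE.
Qed.

(** The excess of the first factor [n.+1] over [n] is absorbed by the third one:
    [n.+1 * n * n.-1 <= n ^ 3].  With two factors only, the bound fails
    for [n > 0]. *)
Lemma ffactSS_leq_exp (n k : nat) : 2 <= k -> n.+1 ^_ k.+1 <= n ^ k.+1.
Proof.
elim: k => // -[|[|k]] // IHk _.
  by rewrite !ffactnS ffactn0 !expnS expn0 /=; nia.
rewrite ffactnSr expnSr leq_mul ?IHk //; lia.
Qed.

Lemma Erdos_Moser_order (k : nat) : 2 <= k ->
  exists2 N : nat, 2 ^ k <= N ^ 2 & N ^_ k.+1 < 2 ^ 'C(k.+1, 2).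
Proof.
move=> hk; have exN : exists N, 2 ^ k <= N ^ 2.
  by exists (2 ^ k); rewrite -expnM leq_exp2l // muln2 -addnn leq_addr.
case: (ex_minnP exN) => -[|n] sqN minN; first by rewrite leqNgt expn_gt0 in sqN.
exists n.+1 => //; apply: leq_ltn_trans (ffactSS_leq_exp n hk) _.
(* After squaring, the claim is [(n ^ 2) ^ k.+1 < (2 ^ k) ^ k.+1]. *)
rewrite -(ltn_exp2r _ _ (isT : 0 < 2)) -!expnM (bin_ffact k.+1 2).
rewrite ffactnS ffactn1 mulnC [_ * k]mulnC !expnM ltn_exp2r //.
by rewrite ltnNge; apply/negP => /minN; rewrite ltnn.
Qed.

(** * Orders [m * N] for all [m] *)

Local Open Scope classical_set_scope.
Local Open Scope ring_scope.

Theorem proposition4p2 (R : realType) (k : nat) (hk : (2 <= k)%N) :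
  infinite_set
    [set n : nat | exists e : rel 'I_n,
       tournament e /\
       (longest_path_power e k)%:R <=
         n%:R * k%:R / (2 : R) `^ (k%:R / 2)].
Proof.
have [N sqN /transitive_free_tournament[e e_tour e_free]] := Erdos_Moser_order hk.
have N_gt0 : (0 < N)%N.
  by case: N sqN {e e_tour e_free} => //; rewrite leqNgt expn_gt0.
have pow_le : (2 : R) `^ (k%:R / 2) <= N%:R.
  rewrite -(@ler_pXn2r _ 2) ?nnegrE ?powR_ge0 ?ler0n //.
  rewrite -powR_mulrn ?powR_ge0 // -powRrM divfK ?pnatr_eq0 // powR_mulrn //.
  by rewrite -!natrX ler_nat.
suff multiples : range (fun m => m * N)%N `<=` [set n : nat | exists e : rel 'I_n,
    tournament e /\ (longest_path_power e k)%:R <=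
      n%:R * k%:R / (2 : R) `^ (k%:R / 2)].
  apply: sub_infinite_set multiples _ => fin; apply: infinite_nat.
  (* Division by [N] maps the multiples of [N] onto [nat]. *)
  have := finite_image (fun n => n %/ N)%N fin; congr (finite_set _).
  rewrite eqEsubset; split=> // m _; exists (m * N)%N; first by exists m.
  by rewrite mulnK.
move=> _ [m _ <-].
have -> : (m * N)%N = #|{: 'I_m * 'I_N}| by rewrite card_prod !card_ord.
pose f : 'I_#|{: 'I_m * 'I_N}| -> 'I_m * 'I_N := enum_val.
have f_inj : injective f by apply: enum_val_inj.
exists (relpre f (lex_sum m e)).
split; first exact: tournament_relpre f_inj (tournament_lex_sum m e_tour).
rewrite ler_pdivlMr ?powR_gt0 //.
have : (longest_path_power (relpre f (lex_sum m e)) k <= m * k)%N.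
  apply: leq_trans (longest_path_power_relpre _ _ f_inj) _.
  apply: leq_path_power_lex_sum e_free (longest_path_power_attained _ _).
  exact: ltnW hk.
rewrite -(ler_nat R) => len_le.
apply: (@le_trans _ _ ((m * k)%:R * N%:R)).
  by apply: ler_pM; rewrite ?ler0n ?powR_ge0.
by rewrite card_prod !card_ord -!natrM ler_nat mulnAC.
Qed.
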